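(* Let $\Gamma=(V,E)$ be a layered directed graph, $V=\cup_{i=0}^n V_i$, with $V_0=\{*\}$ where $*$ is the unique minimal vertex of $\Gamma$. Then $\{\tilde e(\mathbf b)\mid \mathbf b\in\mathbf B(\Gamma)\}$ is a basis of the $F$-vector space $A(\Gamma)$ (the elements $\tilde e(\mathbf b)$, indexed by $\mathbf b\in\mathbf B(\Gamma)$, are linearly independent and span $A(\Gamma)$).
   Context: $F$ is a field. A directed graph $\Gamma=(V,E)$ has a vertex set $V$, an edge set $E$, and functions $\mathbf t,\mathbf h:E\to V$ (tail and head). It is layered if $V=\cup_{i=0}^n V_i$, $E=\cup_{i=1}^n E_i$ (disjoint unions) with $\mathbf t:E_i\to V_i$ and $\mathbf h:E_i\to V_{i-1}$. That $*$ is the unique minimal vertex means that for every $v\in V$, $v\neq *$, there is $e\in E$ with $\mathbf t(e)=v$; for each such $v$ one edge $e_v$ with $\mathbf t(e_v)=v$ is fixed arbitrarily. Write $|v|=i$ if $v\in V_i$. A path from $v$ to $w$ is a sequence of edges $\pi=\{e_1,\dots,e_k\}$ with $\mathbf t(e_1)=v$, $\mathbf h(e_k)=w$, $\mathbf t(e_{i+1})=\mathbf h(e_i)$ for $1\le i<k$; put $\mathbf t(\pi)=v$, $\mathbf h(\pi)=w$, $l(\pi)=k$. Write $v>w$ if there is a path (with at least one edge) from $v$ to $w$. For $v\in V$ put $v^{(0)}=v$, $v^{(i+1)}=\mathbf h(e_{v^{(i)}})$ for $0\le i<|v|$, so $v^{(|v|)}=*$, and let $\pi_v=\{e_{v^{(0)}},\dots,e_{v^{(|v|-1)}}\}$.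 $T(E)$ is the free associative unital $F$-algebra on $E$. For a path $\pi=\{e_1,\dots,e_k\}$ put $P_\pi(t)=(1-te_1)\cdots(1-te_k)\in T(E)[t]/(t^{n+1})$ and define $e(\pi,j)\in T(E)$ by $P_\pi(t)=\sum_{j=0}^{l(\pi)}(-1)^j e(\pi,j)t^j$, with $e(\pi,j)=0$ for $j>l(\pi)$. Put $e(v,j)=e(\pi_v,j)$ for $v\ne *$, and $e( *,0)=1$, $e( *,j)=0$ for $j>0$. $R$ is the two-sided ideal of $T(E)$ generated by all $e(\pi_1,k)-e(\pi_2,k)$ with $\pi_1,\pi_2$ paths such that $\mathbf t(\pi_1)=\mathbf t(\pi_2)$, $\mathbf h(\pi_1)=\mathbf h(\pi_2)$, and $1\le k\le l(\pi_1)$. $A(\Gamma)=T(E)/R$, and $\tilde e(v,k)$ denotes the image of $e(v,k)$ in $A(\Gamma)$. For pairs $(v,k)$, $(u,l)$ with $u,v\in V$, $0\le k\le|v|$, $0\le l\le|u|$, write $(v,k)\models(u,l)$ if $v>u$ and $|u|=|v|-k$. $\mathbf B(\Gamma)$ is the set of all finite sequences $\mathbf b=((b_1,m_1),\dots,(b_s,m_s))$, $s\ge0$ (including the empty sequence), with $b_i\in V$, $1\le m_i\le|b_i|$ for all $i$, and $(b_i,m_i)\not\models(b_{i+1},m_{i+1})$ for $1\le i<s$. For such $\mathbf b$, $\tilde e(\mathbf b)=\tilde e(b_1,m_1)\cdots\tilde e(b_s,m_s)$ (equal to $1$ for the empty sequence). *)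

(* Defs.v *)
From HB Require Import structures.
From mathcomp Require Import all_boot all_algebra.
From mathcomp Require Import generic_quotient ring_quotient.
From mathcomp Require Import boolp classical_sets.
From mathcomp.multinomials Require Import monalg.

Set Implicit Arguments.
Unset Strict Implicit.
Unset Printing Implicit Defensive.

Import GRing.Theory.
Local Open Scope ring_scope.
Local Open Scope classical_set_scope.

Section TwoSidedIdeal.
Variables (F : fieldType) (L : lalgType F).

Definition two_sided_ideal (I : set L) : Prop :=
  [/\ I 0, forall x y, I x -> I y -> I (x - y),
      forall a x, I x -> I (a * x) & forall a x, I x -> I (x * a)].

Definition ideal_gen (S : set L) : set L := smallest two_sided_ideal S.

Lemma ideal_gen_ideal (S : set L) : two_sided_ideal (ideal_gen S).
Proof.
split.
- by move=> I [[]].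
- by move=> x y Sx Sy I IS; case: (IS) => -[_ IB _ _] _; apply: IB; [apply: Sx|apply: Sy].
- by move=> a x Sx I IS; case: (IS) => -[_ _ IM _] _; apply: IM; apply: Sx.
- by move=> a x Sx I IS; case: (IS) => -[_ _ _ IM] _; apply: IM; apply: Sx.
Qed.

End TwoSidedIdeal.

(* ring_quotient only provides the ring structure on quotients of commutative
   rings; below, the quotient of an F-algebra L by the two-sided ideal generated
   by S is given its ring and F-module structures. The quotient is not a
   lalgType because it can be trivial; quot_scaleAl is the missing axiom. *)
Section QuotientAlgebra.
Variables (F : fieldType) (L : lalgType F) (S : set L).

Definition ideal_pred : L -> bool := fun x => `[< ideal_gen S x >].

Fact ideal_pred_zmod_closed : zmod_closed ideal_pred.
Proof.
have [I0 IB _ _] := ideal_gen_ideal S; split; first exact/asboolP.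
by move=> x y /asboolP Ix /asboolP Iy; apply/asboolP; apply: IB.
Qed.
HB.instance Definition _ :=
  GRing.isZmodClosed.Build L ideal_pred ideal_pred_zmod_closed.

Let idealP : zmodClosed L := GRing.ZmodClosed.clone L ideal_pred _.

Definition quot_alg : Type := Quotient.quot idealP.

HB.instance Definition _ := GRing.Zmodule.on quot_alg.
HB.instance Definition _ : EqQuotient L (Quotient.equiv idealP) quot_alg :=
  EqQuotient.on quot_alg.

Definition to_quot (x : L) : quot_alg := \pi_(Quotient.quot idealP)%qT x.

Lemma to_quot_eq x y : to_quot x = to_quot y <-> ideal_gen S (x - y).
Proof.
split=> [/eqP|Ixy].
  by rewrite -Quotient.idealrBE => /asboolP.
by apply/eqP; rewrite -Quotient.idealrBE; apply/asboolP.
Qed.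

Let rep (q : quot_alg) : L := repr q.

Lemma repK q : to_quot (rep q) = q.
Proof. exact: reprK. Qed.

Lemma to_quotB : {morph to_quot : x y / x - y}.
Proof. by move=> x y; rewrite /to_quot !piE. Qed.
Lemma to_quotD : {morph to_quot : x y / x + y}.
Proof. by move=> x y; rewrite /to_quot !piE. Qed.
Lemma to_quot0 : to_quot 0 = 0.
Proof. by rewrite -(subrr 0) to_quotB subrr. Qed.

Definition quot_one : quot_alg := to_quot 1.
Definition quot_mul (p q : quot_alg) : quot_alg := to_quot (rep p * rep q).
Definition quot_scale (a : F) (q : quot_alg) : quot_alg := to_quot (a *: rep q).

Fact to_quot_mul x y : quot_mul (to_quot x) (to_quot y) = to_quot (x * y).
Proof.
have [I0 IB IMl IMr] := ideal_gen_ideal S.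
have /to_quot_eq Hx := repK (to_quot x).
have /to_quot_eq Hy := repK (to_quot y).
apply/to_quot_eq.
have -> : rep (to_quot x) * rep (to_quot y) - x * y
    = (rep (to_quot x) - x) * rep (to_quot y) - (- x) * (rep (to_quot y) - y).
  by rewrite mulrBl mulNr opprK mulrBr addrA subrK.
by apply: IB; [apply: IMr|apply: IMl].
Qed.

Fact to_quot_scale a x : quot_scale a (to_quot x) = to_quot (a *: x).
Proof.
have [_ _ IMl _] := ideal_gen_ideal S.
have /to_quot_eq Hx := repK (to_quot x).
apply/to_quot_eq; rewrite -scalerBr -[_ - _]mul1r scalerAl.
exact: IMl.
Qed.

Let quotW (P : quot_alg -> Prop) : (forall x, P (to_quot x)) -> forall q, P q.
Proof. by move=> PP q; rewrite -(repK q). Qed.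

Fact quot_mulA : associative quot_mul.
Proof.
elim/quotW=> x; elim/quotW=> y; elim/quotW=> z.
by rewrite !to_quot_mul mulrA.
Qed.
Fact quot_mul1 : left_id quot_one quot_mul.
Proof. by elim/quotW=> x; rewrite to_quot_mul mul1r. Qed.
Fact quot_mulr1 : right_id quot_one quot_mul.
Proof. by elim/quotW=> x; rewrite to_quot_mul mulr1. Qed.
Fact quot_mulDl : left_distributive quot_mul +%R.
Proof.
elim/quotW=> x; elim/quotW=> y; elim/quotW=> z.
by rewrite -to_quotD !to_quot_mul mulrDl to_quotD.
Qed.
Fact quot_mulDr : right_distributive quot_mul +%R.
Proof.
elim/quotW=> x; elim/quotW=> y; elim/quotW=> z.
by rewrite -to_quotD !to_quot_mul mulrDr to_quotD.
Qed.
HB.instance Definition _ := GRing.Zmodule_isPzRing.Build quot_alg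
  quot_mulA quot_mul1 quot_mulr1 quot_mulDl quot_mulDr.

Fact quot_scaleA a b q : quot_scale a (quot_scale b q) = quot_scale (a * b) q.
Proof. by elim/quotW: q => x; rewrite !to_quot_scale scalerA. Qed.
Fact quot_scale1 : left_id 1 quot_scale.
Proof. by elim/quotW=> x; rewrite to_quot_scale scale1r. Qed.
Fact quot_scaleDr : right_distributive quot_scale +%R.
Proof.
move=> a; elim/quotW=> x; elim/quotW=> y.
by rewrite -to_quotD !to_quot_scale scalerDr to_quotD.
Qed.
Fact quot_scaleDl q : {morph quot_scale^~ q : a b / a + b}.
Proof. by move=> a b; elim/quotW: q => x; rewrite !to_quot_scale scalerDl to_quotD. Qed.
HB.instance Definition _ := GRing.Zmodule_isLmodule.Build F quot_alg
  quot_scaleA quot_scale1 quot_scaleDr quot_scaleDl.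

Fact quot_scaleAl (a : F) (p q : quot_alg) : a *: (p * q) = (a *: p) * q.
Proof.
elim/quotW: p => x; elim/quotW: q => y.
change (quot_scale a (quot_mul (to_quot x) (to_quot y))
  = quot_mul (quot_scale a (to_quot x)) (to_quot y)).
by rewrite to_quot_mul !to_quot_scale to_quot_mul -scalerAl.
Qed.

Fact to_quot_linear : linear to_quot.
Proof. by move=> a x y; rewrite to_quotD -to_quot_scale. Qed.
HB.instance Definition _ :=
  GRing.isLinear.Build F L quot_alg *:%R to_quot to_quot_linear.

Fact to_quot_monoid_morphism : monoid_morphism to_quot.
Proof. by split=> // x y; rewrite -to_quot_mul. Qed.
HB.instance Definition _ :=
  GRing.isMonoidMorphism.Build L quot_alg to_quot to_quot_monoid_morphism.

End QuotientAlgebra.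

Section Basis.
Variables (F : fieldType) (M : lmodType F) (I : choiceType).
Variables (D : set I) (f : I -> M).

Definition lin_indep : Prop :=
  forall (s : seq I) (c : I -> F), uniq s -> (forall i, i \in s -> D i) ->
    \sum_(i <- s) c i *: f i = 0 -> forall i, i \in s -> c i = 0.

Definition spanning : Prop :=
  forall x : M, exists (s : seq I) (c : I -> F),
    (forall i, i \in s -> D i) /\ x = \sum_(i <- s) c i *: f i.

Definition is_basis : Prop := lin_indep /\ spanning.

End Basis.

Record digraph := Digraph {
  vertex : choiceType;
  edge : choiceType;
  etail : edge -> vertex;
  ehead : edge -> vertex }.

Section LayeredGraph.
Variables (G : digraph) (n : nat) (lev : vertex G -> nat).

(* V_i = {v | lev v = i} and E_i = {e | lev (etail e) = i} for i <= n. *)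
Definition layered : Prop :=
  (forall v, (lev v <= n)%N)
  /\ (forall e : edge G, lev (etail e) = (lev (ehead e)).+1).

Definition unique_minimal (star : vertex G) : Prop :=
  forall v, v != star -> exists e : edge G, etail e = v.

(* Paths have at least one edge. *)
Definition is_path (v w : vertex G) (p : seq (edge G)) : bool :=
  if p is e :: q then
    [&& etail e == v, path (fun e1 e2 => etail e2 == ehead e1) e q
      & ehead (last e q) == w]
  else false.

Definition gtv (v w : vertex G) : Prop := exists p, is_path v w p.

Definition models (a b : vertex G * nat) : Prop :=
  gtv a.1 b.1 /\ lev b.1 = (lev a.1 - a.2)%N.

Definition Bset : set (seq (vertex G * nat)) :=
  [set b | (forall a, a \in b -> (1 <= a.2 <= lev a.1)%N)
           /\ sorted (fun a a' => ~~ `[< models a a' >]) b].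

End LayeredGraph.

Section AlgebraOfGraph.
Variables (F : fieldType) (G : digraph).

Definition freeAlg : lalgType F := {malg F[{fmonom (edge G)}]}.

Definition egen (e : edge G) : freeAlg := << fmu e >>.

(* A path of a layered graph with levels 0..n has at most n edges, so working
   in T(E)[t] instead of T(E)[t]/(t^(n+1)) loses nothing; t is central. *)
Definition pathpoly (p : seq (edge G)) : {poly freeAlg} :=
  \prod_(e <- p) (1 - (egen e)%:P * 'X).

Definition epath (p : seq (edge G)) (j : nat) : freeAlg :=
  (-1) ^+ j * (pathpoly p)`_j.

Definition relators : set freeAlg :=
  [set x | exists p1 p2 v w k,
     [/\ is_path v w p1, is_path v w p2, (1 <= k <= size p1)%N
       & x = epath p1 k - epath p2 k]].

Definition AG : Type := quot_alg relators.
HB.instance Definition _ := GRing.PzRing.on AG.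
HB.instance Definition _ := GRing.Lmodule.on AG.

Section DistinguishedPaths.
Variables (lev : vertex G -> nat) (star : vertex G).
Variable ev : {v : vertex G | v != star} -> edge G.

Fixpoint canon_walk (k : nat) (v : vertex G) : seq (edge G) :=
  if k is k'.+1 then
    if insub v is Some u then ev u :: canon_walk k' (ehead (ev u)) else [::]
  else [::].

(* canon_path star = [::], whose polynomial is 1, so evert covers the
   conventions e(star, 0) = 1 and e(star, j) = 0 for j > 0. *)
Definition canon_path (v : vertex G) : seq (edge G) := canon_walk (lev v) v.

Definition evert (v : vertex G) (j : nat) : freeAlg := epath (canon_path v) j.

Definition etilde (v : vertex G) (j : nat) : AG := to_quot relators (evert v j).

Definition etilde_seq (b : seq (vertex G * nat)) : AG :=
  \prod_(a <- b) etilde a.1 a.2.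

End DistinguishedPaths.
End AlgebraOfGraph.

(* Main.v *)
From HB Require Import structures.
Require Import Defs.
From mathcomp Require Import all_boot all_order all_algebra.
From mathcomp Require Import boolp classical_sets.
From mathcomp.multinomials Require Import monalg.
From mathcomp Require Import finmap zify.

Set Implicit Arguments.
Unset Strict Implicit.
Unset Printing Implicit Defensive.

Import GRing.Theory.
Local Open Scope ring_scope.

(** Write E_v(t) for the polynomial with coefficients the classes of e(v,k);
    the sign (-1)^k is absorbed by t := -t.  Any two paths with the same ends
    have the same polynomial in A(Gamma), so E_v(t) = P_p(t) E_w(t) for every
    path p from v to w, and the relations amount to
    E_v(t) = (1 + t e) E_w(t) for all edges e from v to w.

    The theorem is proved by making the vector space N with basis all words in
    the letters (v,k) carry operators act_u(t) that play the role of right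
    multiplication by E_u(t).  A letter (u,l) is simply appended to a word
    whose last letter does not model (u,l).  If the word is c(a,k) and (a,k)
    models (u,l), so that a > u and |u| = |a| - k, the value is forced: c E_a(t)
    consists of words obtained by appending a letter to c, it has to be
    Q(t) E_u(t) with Q of degree at most k, the coefficients of Q below t^k are
    obtained by dividing power series, and the coefficient of t^k is c(a,k) plus
    terms on which the action of E_u is known.  This is a recursion on the
    length of the word ([act1]).

    The span of the normal words (those of B(Gamma)) is stable
    ([act1_extendable]).  On it act_v(t) = (1 + t R_e) act_w(t) for each edge
    e : v -> w, where R_e is the difference of the coefficients of t
    ([act_edge]).  This comes from a bound on the degree of act_v(t) divided by
    act_w(t) ([divop_deg]), which also goes by induction on the length: for a
    word c(a,k) whose last letter models v, the quotient of
    c E_a(t) = Q(t) act_v(t) by act_w(t) has degree at most k+1, and those of all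
    terms of Q(t) act_v(t) other than t^k c(a,k) act_v(t) have the expected
    degrees; so does what remains.

    Letting each edge e act by R_e, the free algebra acts on the normal span,
    and the relators act by zero because act_w(t) is invertible
    ([relators_annihilate]).  The product of the e(b_i,m_i) over a normal word
    sends the empty word to that word ([freeop_word]), hence linear
    independence.  Conversely the linear map from N to A(Gamma) that sends a
    word to its product intertwines R_e with right multiplication by e
    ([wordval_monop]); since the normal span is stable under all R_e, its image
    is all of A(Gamma). *)

(** * Power series with operator coefficients *)

Lemma sum_ord_cut (V : nmodType) (f : nat -> V) k m : (k <= m)%N ->
  (forall i, (k < i)%N -> f i = 0) -> \sum_(i < m.+1) f i = \sum_(i < k.+1) f i.
Proof.
move=> lekm f0; rewrite -(big_mkord xpredT f) (@big_cat_nat _ _ _ k.+1) //=.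
rewrite [X in _ + X]big_nat [X in _ + X]big1 ?addr0 ?big_mkord //.
by move=> i /andP[ltki _]; apply: f0.
Qed.

Section Series.
Variables (F : fieldType) (N : lmodType F).
Implicit Types (T U : nat -> {linear N -> N}) (q r : nat -> N).

(** The m-th coefficient of the product of the series q(t), with coefficients in
    N, by the operator series T(t), thought of as acting from the right. *)
Definition conv T q (m : nat) : N := \sum_(i < m.+1) T (m - i)%N (q i).

(** Recursion on the number k of coefficients that may be computed, as the
    coefficient of index i calls all the preceding ones. *)
Fixpoint quotient_upto T r (k : nat) : nat -> N :=
  if k is k'.+1 then
    fun i => r i - \sum_(j < i) T (i - j)%N (quotient_upto T r k' j)
  else fun=> 0.

(** When T(0) is the identity, the unique series q with q(t) T(t) = r(t). *)
Definition quotient T r (i : nat) : N := quotient_upto T r i.+1 i.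

Lemma quotient_rec T r i :
  quotient T r i = r i - \sum_(j < i) T (i - j)%N (quotient T r j).
Proof.
have stable k k' j : (j < k)%N -> (j < k')%N ->
    quotient_upto T r k j = quotient_upto T r k' j.
  elim: k k' j => // k IHk [|k'] // j /= ltjk ltjk'; congr (_ - _).
  apply: eq_bigr => p _; congr (T _ _).
  by apply: IHk; apply: leq_trans (ltn_ord p) _.
rewrite {1}/quotient /quotient_upto -/quotient_upto; congr (_ - _).
by apply: eq_bigr => j _; congr (T _ _); apply: stable.
Qed.

Lemma conv_recr T q m : T 0%N =1 id ->
  conv T q m = \sum_(i < m) T (m - i)%N (q i) + q m.
Proof. by move=> T0; rewrite /conv big_ord_recr /= subnn T0. Qed.

Lemma conv_quotient T r m : T 0%N =1 id -> conv T (quotient T r) m = r m.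
Proof.
by move=> T0; rewrite conv_recr // [quotient T r m]quotient_rec addrC subrK.
Qed.

(** An operator series with constant coefficient 1 can be cancelled. *)
Lemma conv_inj T q q' : T 0%N =1 id -> conv T q =1 conv T q' -> q =1 q'.
Proof.
move=> T0 eqqq' m; have [k] := ubnP m; elim: k m => // k IHk m ltmk.
have := eqqq' m; rewrite !conv_recr // => /eqP.
under eq_bigr => i _ do rewrite (IHk i (leq_trans (ltn_ord i) ltmk)).
by rewrite (inj_eq (addrI _)) => /eqP.
Qed.

Lemma quotient_is_linear T U i :
  linear (fun x => quotient T (fun m => U m x) i).
Proof.
move=> c x y; have [k] := ubnP i; elim: k i => // k IHk i ltik.
rewrite !(quotient_rec _ _ i) linearP; under eq_bigr => j _.
  rewrite (IHk j (leq_trans (ltn_ord j) ltik)) linearP; over.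
by rewrite big_split /= -scaler_sumr scalerBr opprD addrACA.
Qed.

(** The coefficients of U(t) T(t)^-1, as operators on N. *)
Definition divop T U i : N -> N := fun x => quotient T (fun m => U m x) i.
HB.instance Definition _ T U i :=
  GRing.isLinear.Build F N N *:%R (divop T U i) (quotient_is_linear T U i).

Lemma sum_triangle (f : nat -> nat -> N) m :
  \sum_(j < m.+1) \sum_(i < (m - j).+1) f j i
    = \sum_(p < m.+1) \sum_(j < p.+1) f j (p - j)%N.
Proof.
elim: m => [|m IHm]; first by rewrite !big_ord1.
rewrite [RHS]big_ord_recr /= -IHm [LHS]big_ord_recr /= subnn big_ord1.
rewrite [X in _ = _ + X]big_ord_recr /= subnn addrA; congr (_ + _).
rewrite -big_split /=; apply: eq_bigr => j _.
by rewrite subSn -1?ltnS // big_ord_recr.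
Qed.

Lemma conv_divop T U q m : T 0%N =1 id ->
  conv U q m = conv T (fun p => \sum_(j < p.+1) divop T U (p - j)%N (q j)) m.
Proof.
move=> T0; rewrite /conv.
transitivity (\sum_(j < m.+1) \sum_(i < (m - j).+1)
    T (m - j - i)%N (divop T U i (q j))).
  by apply: eq_bigr => j _; rewrite -(conv_quotient (fun p => U p (q j)) _ T0).
rewrite (sum_triangle (fun j i => T (m - j - i)%N (divop T U i (q j)))).
apply: eq_bigr => p _; rewrite linear_sum; apply: eq_bigr => j _.
by rewrite -subnDA subnKC // -ltnS.
Qed.
End Series.

(** * Linear maps out of a free module *)

Section Malg.
Variables (F : fieldType) (K : choiceType).
Local Notation N := {malg F[K]}.

Lemma malgU_scale (c : F) (k : K) : << c *g k >> = c *: << k >> :> N.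
Proof. by apply/malgP => k'; rewrite mcoeffZ !mcoeffU mulrnAr mulr1. Qed.

Lemma malg_sumU (x : N) : x = \sum_(k <- msupp x) x@_k *: << k >>.
Proof.
by rewrite {1}[x]monalgE; apply: eq_bigr => k _; rewrite malgU_scale.
Qed.

Section Extension.
Variables (M : lmodType F) (f : K -> M).

Definition lext (x : N) : M := \sum_(k <- msupp x) x@_k *: f k.

Lemma lextEw (d : {fset K}) (x : N) : (msupp x `<=` d)%fset ->
  lext x = \sum_(k <- d) x@_k *: f k.
Proof.
move=> sub; rewrite /lext (big_fset_incl _ sub) //= => k _ kx.
by rewrite (mcoeff_outdom kx) scale0r.
Qed.

Lemma lext_is_linear : linear lext.
Proof.
move=> c x y; pose d := (msupp x `|` msupp y `|` msupp (c *: x + y))%fset.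
have sub1 : (msupp x `<=` d)%fset by rewrite /d -fsetUA fsubsetUl.
have sub2 : (msupp y `<=` d)%fset by rewrite /d fsetUAC fsubsetUr.
have sub3 : (msupp (c *: x + y) `<=` d)%fset by exact: fsubsetUr.
rewrite !(lextEw sub1, lextEw sub2, lextEw sub3) scaler_sumr -big_split.
by apply: eq_bigr => k _; rewrite mcoeffD mcoeffZ scalerDl scalerA.
Qed.
HB.instance Definition _ := GRing.isLinear.Build F N M *:%R lext lext_is_linear.

Lemma lextU k : lext << k >> = f k.
Proof.
have /lextEw -> : (msupp (<< k >> : N) `<=` [fset k])%fset by exact: msuppU_le.
by rewrite big_seq_fset1 mcoeffUU scale1r.
Qed.
End Extension.

Lemma linear_malgE (M : lmodType F) (f : {linear N -> M}) (x : N) :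
  f x = \sum_(k <- msupp x) x@_k *: f << k >>.
Proof.
rewrite {1}(malg_sumU x) linear_sum.
by apply: eq_bigr => k _; rewrite linearZ.
Qed.

Definition inspan (P : pred K) (x : N) : Prop := forall k, x@_k != 0 -> P k.

Lemma inspan0 P : inspan P 0.
Proof. by move=> k; rewrite mcoeff0 eqxx. Qed.
Lemma inspanU (P : pred K) k : P k -> inspan P << k >>.
Proof.
by move=> Pk k'; rewrite mcoeffU; case: (k =P k') => [<-|_]; rewrite ?eqxx.
Qed.
Lemma inspanD P x y : inspan P x -> inspan P y -> inspan P (x + y).
Proof.
move=> Px Py k; rewrite mcoeffD.
have [->|/Px //] := eqVneq x@_k 0; rewrite add0r; exact: Py.
Qed.
Lemma inspanZ P c x : inspan P x -> inspan P (c *: x).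
Proof. by move=> Px k; rewrite mcoeffZ mulf_eq0 negb_or => /andP[_ /Px]. Qed.
Lemma inspanB P x y : inspan P x -> inspan P y -> inspan P (x - y).
Proof.
by move=> Px Py; apply: inspanD => //; rewrite -scaleN1r; apply: inspanZ.
Qed.
Lemma inspan_sum P (I : Type) (s : seq I) (A : pred I) (f : I -> N) :
  (forall i, A i -> inspan P (f i)) -> inspan P (\sum_(i <- s | A i) f i).
Proof.
move=> Pf; apply: (big_ind (inspan P)) => //; first exact: inspan0.
exact: inspanD.
Qed.
Lemma inspanW (P P' : pred K) x :
  (forall k, P k -> P' k) -> inspan P x -> inspan P' x.
Proof. by move=> PP' Px k /Px /PP'. Qed.

Lemma inspan_eq (M : lmodType F) (f g : {linear N -> M}) (P : pred K) x :
  (forall k, P k -> f << k >> = g << k >>) -> inspan P x -> f x = g x.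
Proof.
move=> fg Px; rewrite !linear_malgE big_seq [RHS]big_seq; apply: eq_bigr => k.
by rewrite -mcoeff_neq0 => /Px /fg ->.
Qed.

End Malg.

Lemma inspan_map (F : fieldType) (K K' : choiceType) (P : pred K) (P' : pred K')
    (f : {linear {malg F[K]} -> {malg F[K']}}) x :
  (forall k, P k -> inspan P' (f << k >>)) -> inspan P x -> inspan P' (f x).
Proof.
move=> Pf Px; rewrite linear_malgE big_seq; apply: inspan_sum => k.
by rewrite -mcoeff_neq0 => /Px /Pf; apply: inspanZ.
Qed.

(** * Walks in a layered graph *)

Section Paths.
Variables (G : digraph) (lev : vertex G -> nat).
Implicit Types (v u w : vertex G) (e : edge G) (p : seq (edge G)).

(** Adding the empty path makes the factorization E_v = P_p E_w uniform in p
    and lets inductions on paths start at length 0. *)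
Definition walk v w p : bool := if p is [::] then v == w else is_path v w p.

Lemma is_path_cons v w e p :
  is_path v w (e :: p) = (etail e == v) && walk (ehead e) w p.
Proof. by case: p => [|e' p] //=; rewrite -andbA. Qed.

Lemma walk_cons v w e p :
  walk v w (e :: p) = (etail e == v) && walk (ehead e) w p.
Proof. exact: is_path_cons. Qed.

Lemma walk_cat v u w p q : walk v u p -> walk u w q -> walk v w (p ++ q).
Proof.
move=> + uq; elim: p v => [|e p IHp] v; first by move=> /eqP ->.
by rewrite cat_cons !walk_cons => /andP[-> /IHp].
Qed.

Lemma gtv_trans v u w : gtv v u -> gtv u w -> gtv v w.
Proof.
move=> [[|e p] // ep] [[|e' q] // eq]; exists ((e :: p) ++ e' :: q).
exact: (walk_cat (p := e :: p) (q := e' :: q) ep eq).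
Qed.

Lemma gtv_edge (e : edge G) : gtv (etail e) (ehead e).
Proof. by exists [:: e]; rewrite is_path_cons /walk !eqxx. Qed.

Hypothesis lev_edge : forall e : edge G, lev (etail e) = (lev (ehead e)).+1.

Lemma walk_lev v w p : walk v w p -> lev v = (lev w + size p)%N.
Proof.
elim: p v => [|e p IHp] v; first by move=> /eqP ->; rewrite addn0.
by rewrite walk_cons => /andP[/eqP <- /IHp lE]; rewrite lev_edge lE addnS.
Qed.

Lemma gtv_lev v w : gtv v w -> (lev w < lev v)%N.
Proof.
move=> [[|e p] // ep].
by rewrite (walk_lev (p := e :: p) ep) /= addnS ltnS leq_addr.
Qed.
End Paths.

(** * The right action on words *)

Section RightModule.
Variables (F : fieldType) (G : digraph) (lev : vertex G -> nat).
Hypothesis lev_edge : forall e : edge G, lev (etail e) = (lev (ehead e)).+1.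

(** Words are stored with their last letter first, so that right multiplication
    works at the head of the list; they are the reversals of the elements of
    B(Gamma). *)
Definition word := seq (vertex G * nat).
HB.instance Definition _ := Choice.on word.
Local Notation N := {malg F[word]}.
Implicit Types (a u v : vertex G) (x : vertex G * nat) (c w : word) (n : N).

(** The relation x |= (u,l), which is the same for all l. *)
Definition reducible x u : bool :=
  `[< gtv x.1 u >] && (lev u == lev x.1 - x.2)%N.

Definition follows w u : bool :=
  if w is x :: _ then ~~ reducible x u else true.

Definition normal w : bool :=
  all (fun x => (1 <= x.2 <= lev x.1)%N) w
  && sorted (fun x y => ~~ reducible y x.1) w.

Lemma normal_cons x c :
  normal (x :: c) = [&& (1 <= x.2 <= lev x.1)%N, follows c x.1 & normal c].
Proof.
rewrite /normal /=; case: c => [|y c] /=; first by rewrite !andbT.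
by rewrite -andbA; case: (0 < _ <= lev x.1)%N; rewrite /= ?andbF // andbCA.
Qed.

Lemma Bset_normal (b : word) : Bset lev b <-> normal (rev b).
Proof.
have modelsE : sorted (fun x y => ~~ `[< models lev x y >]) b
    = sorted (fun x y => ~~ reducible x y.1) b.
  apply: eq_sorted => x y; congr (~~ _); rewrite /reducible.
  by apply/asboolP/andP => -[/asboolP ? /eqP ?]; split=> //; apply/asboolP.
rewrite /Bset /= modelsE /normal all_rev rev_sorted.
split=> [[/allP-> ->]|/andP[/allP ? ->]] //.
Qed.

Lemma reducible_irr u l : reducible (u, l) u = false.
Proof. by apply/negP => /andP[/asboolP /(gtv_lev lev_edge)]; rewrite ltnn. Qed.

(** The words w such that w(u,l) is normal for all l from 1 to |u|. *)
Definition extendable u : pred word := fun w => normal w && follows w u.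

(** Naive right multiplication by the coefficients of E_u(t), following the
    conventions e(u,0) = 1 and e(u,l) = 0 for l > |u|. *)
Definition append1 u (l : nat) w : N :=
  if l is 0 then << w >> else if (l <= lev u)%N then << (u, l) :: w >> else 0.

Definition append u l : {linear N -> N} := lext (append1 u l).
Arguments append : simpl never.

Lemma appendU u l w : append u l << w >> = append1 u l w.
Proof. exact: lextU. Qed.

Lemma append0 u : append u 0%N =1 id.
Proof.
move=> n; rewrite [RHS]malg_sumU [LHS]linear_malgE.
by under eq_bigr do rewrite appendU.
Qed.

Lemma append_big u l n : (lev u < l)%N -> append u l n = 0.
Proof.
case: l => // l ltl; rewrite linear_malgE big1 // => w _.
by rewrite appendU /append1 leqNgt ltl scaler0.
Qed.

(** Since u > u never holds, two letters at u may always be adjacent. *)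
Lemma append_extendable u l n : (0 < l)%N ->
  inspan (extendable u) n -> inspan (extendable u) (append u l n).
Proof.
case: l => // l _; apply: inspan_map => w /andP[nw fw].
rewrite appendU /append1.
case: ifP => [lel|_]; last exact: inspan0.
by apply: inspanU; rewrite /extendable normal_cons /= lel fw nw reducible_irr.
Qed.

(** The true right action of E_u(t) on a word.  For a normal word c(a,k) with
    (a,k) |= u, let r(t) = c E_a(t) - c E_u(t) and q(t) = r(t) append_u(t)^-1.
    The quotient Q(t) of c E_a(t) by E_u(t) is c + q_1 t + .. + q_k t^k: its
    coefficients of index 1 to k-1, and q_k - c(a,k), involve only words to
    which letters at u can be appended.  Solving Q(t) E_u(t) = c E_a(t) for the
    contribution t^k c(a,k) E_u(t) of the word c(a,k) gives
      t^k append_u(t) c(a,k) + r(t) - (q_1 t + .. + q_k t^k) append_u(t),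
    whose coefficient of t^(k+l) is the value below. *)
Fixpoint act1 w u (l : nat) : N :=
  append1 u l w +
  if w is (a, k) :: c then
    if reducible (a, k) u then
      let r m := append1 a m c - act1 c u m in
      r (k + l)%N
        - \sum_(i < k.+1) append u (k + l - i)%N (quotient (append u) r i)
    else 0
  else 0.

Definition act u l : {linear N -> N} := lext (fun w => act1 w u l).
Arguments act : simpl never.

Lemma actU u l w : act u l << w >> = act1 w u l.
Proof. exact: lextU. Qed.

(** The series r(t) and q(t) in the definition of the action. *)
Definition defect a u c (m : nat) : N := append1 a m c - act1 c u m.
Definition tail a u c : nat -> N := quotient (append u) (defect a u c).

Lemma act1_irreducible w u l : follows w u -> act1 w u l = append1 u l w.
Proof. by case: w => [|[a k] c] /= => [|/negPf ->]; rewrite addr0. Qed.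

Lemma act1_reducible a k c u l : reducible (a, k) u -> act1 ((a, k) :: c) u l
  = append1 u l ((a, k) :: c) + (defect a u c (k + l)
    - \sum_(i < k.+1) append u (k + l - i)%N (tail a u c i)).
Proof. by move=> /= ->. Qed.

Lemma act1_0 w u : act1 w u 0 = << w >>.
Proof.
case: w => [|[a k] c]; first by rewrite act1_irreducible.
have [akb|/negPf akg] := boolP (reducible (a, k) u); last first.
  by rewrite /= akg addr0.
rewrite act1_reducible // addn0 -[X in _ - X]/(conv (append u) (tail a u c) k).
by rewrite conv_quotient ?subrr ?addr0 //; apply: append0.
Qed.

Lemma act0 u : act u 0%N =1 id.
Proof.
move=> n; rewrite [RHS]malg_sumU [LHS]linear_malgE.
by under eq_bigr do rewrite actU act1_0.
Qed.

Lemma act1_big w u l : (lev u < l)%N -> act1 w u l = 0.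
Proof.
have append1_big v m c : (lev v < m)%N -> append1 v m c = 0.
  by rewrite -appendU; apply: append_big.
elim: w l => [|[a k] c IHc] l ltl.
  by rewrite act1_irreducible // append1_big.
have [akb|akg] := boolP (reducible (a, k) u); last first.
  by rewrite act1_irreducible ?append1_big.
have luE : lev u = (lev a - k)%N by case/andP: akb => _ /eqP.
have ltu_kl : (lev u < k + l)%N by lia.
have lta_kl : (lev a < k + l)%N by lia.
rewrite act1_reducible // append1_big // /defect IHc // append1_big //.
rewrite big1 ?subrr ?addr0 // => i _; apply: append_big.
by have := ltn_ord i; lia.
Qed.

Lemma act_big u l n : (lev u < l)%N -> act u l n = 0.
Proof.
move=> ltl; rewrite linear_malgE big1 // => w _.
by rewrite actU act1_big ?scaler0.
Qed.

Lemma act_extendable u l n :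
  inspan (extendable u) n -> act u l n = append u l n.
Proof.
by apply: inspan_eq => w /andP[_ fw]; rewrite actU appendU act1_irreducible.
Qed.

(** The step from a word c to c(a,k) in the proof of stability: the series
    defining the action on c(a,k) have all their coefficients, except for the
    word c(a,k) itself at index k, in the span of the words to which letters at
    u can be appended. *)
Section OneLetter.
Variables (a u : vertex G) (k : nat) (c : word).
Hypotheses (nc : normal c) (fc : follows c a) (k_range : (1 <= k <= lev a)%N).
Hypothesis akb : reducible (a, k) u.
Hypothesis closed_c : forall l, (0 < l)%N -> inspan (extendable u) (act1 c u l).

(** Among the letters (a,i), only i = k satisfies |u| = |a| - i. *)
Lemma letter_extendable i :
  (1 <= i <= lev a)%N -> i != k -> extendable u ((a, i) :: c).
Proof.
move=> i_range neq_ik; rewrite /extendable normal_cons /= i_range fc nc /=.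
rewrite /reducible negb_and /= orbC; apply/orP; left.
by move: akb => /andP[_ /eqP /= ->]; lia.
Qed.

Lemma defect_extendable i :
  (i != k)%N -> inspan (extendable u) (defect a u c i).
Proof.
move=> neq_ik; rewrite /defect; case: i neq_ik => [|i] neq_ik.
  by rewrite act1_0 subrr; apply: inspan0.
apply: inspanB (closed_c _) => //=; case: ifP => lei; last exact: inspan0.
by apply/inspanU/letter_extendable; rewrite ?lei.
Qed.

Lemma tail_extendable i : (i < k)%N -> inspan (extendable u) (tail a u c i).
Proof.
have [m] := ubnP i; elim: m i => // m IHm i ltim ltik.
rewrite /tail quotient_rec; apply: inspanB.
  by apply: defect_extendable; lia.
apply: inspan_sum => j _; apply: append_extendable; first by rewrite subn_gt0.
by apply: IHm; have := ltn_ord j; lia.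
Qed.

Lemma tail_top : inspan (extendable u) (tail a u c k - << (a, k) :: c >>).
Proof.
rewrite /tail quotient_rec -/(tail a u c) {1}/defect.
have -> : append1 a k c = << (a, k) :: c >>.
  by case: (k) k_range => // k' /= ->.
rewrite addrAC [X in X - _]addrAC subrr sub0r.
have k_gt0 : (0 < k)%N by case/andP: k_range.
apply: inspanB; first by rewrite -scaleN1r; apply/inspanZ/closed_c.
apply: inspan_sum => j _; apply: append_extendable; first by rewrite subn_gt0.
by apply: tail_extendable.
Qed.
End OneLetter.

(** Multiplying by a letter at u leaves only normal words to which letters at u
    can be appended again: in the reducible case the word c(a,k) cancels between
    t^k append_u(t) c(a,k) and the last term of the sum. *)
Lemma act1_extendable w u l :
  normal w -> (0 < l)%N -> inspan (extendable u) (act1 w u l).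
Proof.
elim: w l => [|[a k] c IHc] l nw l_gt0.
  rewrite act1_irreducible // -appendU.
  by apply: append_extendable => //; apply: inspanU.
have [akb|akg] := boolP (reducible (a, k) u); last first.
  rewrite act1_irreducible // -appendU; apply: append_extendable => //.
  by apply: inspanU; rewrite /extendable nw.
have [k_range fc nc] : [/\ (1 <= k <= lev a)%N, follows c a & normal c].
  by apply/and3P; rewrite normal_cons in nw.
have {IHc} closed_c m := IHc m nc.
have reorder (x d s y : N) : x + (d - (s + y)) = d - s - (y - x).
  by rewrite opprD opprB addrCA (addrCA x) addrA.
rewrite act1_reducible // big_ord_recr reorder -appendU.
rewrite (_ : (k + l - k = l)%N); last by lia.
rewrite -linearB.
apply: inspanB; last first.
  apply: append_extendable => //.
  exact: (tail_top nc fc k_range akb closed_c).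
apply: inspanB.
  by apply: (defect_extendable nc fc k_range akb closed_c); lia.
apply: inspan_sum => j _; apply: append_extendable.
  by move=> /=; have := ltn_ord j; lia.
exact: (tail_extendable nc fc k_range akb closed_c (ltn_ord j)).
Qed.

Lemma act_normal u l n : inspan normal n -> inspan normal (act u l n).
Proof.
apply: inspan_map => w nw; rewrite actU; case: l => [|l].
  by rewrite act1_0; apply: inspanU.
apply: (@inspanW _ _ (extendable u)) => [w' /andP[]//|].
exact: act1_extendable.
Qed.

(** The polynomial Q(t) = c + q_1 t + .. + q_k t^k (as q_0 = 0). *)
Definition factor a u c (k i : nat) : N :=
  (if i is 0 then << c >> else 0) + (if (i <= k)%N then tail a u c i else 0).

(** The action is built so that c E_a(t) = Q(t) E_u(t) for a > u: below t^k this
    is the division by append_u(t), from t^k on it is the formula for the action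
    on c(a,k). *)
Lemma factor_conv a u c m : normal c -> follows c a -> gtv a u ->
  append1 a m c = conv (act u) (factor a u c (lev a - lev u)) m.
Proof.
move=> nc fc gau; set k := (lev a - lev u)%N.
have ltua := gtv_lev lev_edge gau.
have k_range : (1 <= k <= lev a)%N by rewrite /k; lia.
have akb : reducible (a, k) u.
  by rewrite /reducible /=; apply/andP; split; [apply/asboolP|rewrite /k; lia].
have closed_c l : (0 < l)%N -> inspan (extendable u) (act1 c u l).
  exact: act1_extendable.
rewrite /conv; under eq_bigr => i _ do rewrite /factor linearD.
rewrite big_split big_ord_recl /= subn0 actU big1 ?addr0 => [|i _]; last first.
  by rewrite linear0.
apply/eqP; rewrite addrC -subr_eq -/(defect a u c m); apply/eqP.
have act_low i j : (i < k)%N ->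
    act u j (tail a u c i) = append u j (tail a u c i).
  move=> ltik; apply: act_extendable.
  exact: (tail_extendable nc fc k_range akb closed_c ltik).
have [ltmk|lekm] := ltnP m k.
  rewrite -(conv_quotient (defect a u c) m (@append0 u)); apply: eq_bigr => i _.
  have lt_ik: (i < k)%N by have := ltn_ord i; lia.
  by rewrite (ltnW lt_ik) act_low.
rewrite (@sum_ord_cut _ (fun i => act u (m - i)%N
  (if (i <= k)%N then tail a u c i else 0)) _ _ lekm); last first.
  by move=> i ltki; rewrite leqNgt ltki linear0.
rewrite big_ord_recr /= leqnn.
under eq_bigr => i _ do rewrite (ltnW (ltn_ord i)) act_low //.
have -> : act u (m - k)%N (tail a u c k) = append u (m - k) (tail a u c k)
    + (defect a u c m - \sum_(i < k.+1) append u (m - i)%N (tail a u c i)).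
  rewrite -[in LHS](subrK << (a, k) :: c >> (tail a u c k)) linearD /=.
  rewrite (act_extendable _ (tail_top nc fc k_range akb closed_c)) actU.
  rewrite act1_reducible //.
  by rewrite -appendU subnKC // addrA -linearD subrK.
by rewrite [X in _ - X]big_ord_recr /= addrA addrC subrK.
Qed.

Lemma divop_factor a u c m : normal c -> follows c a -> gtv a u ->
  divop (act u) (act a) m << c >> = factor a u c (lev a - lev u) m.
Proof.
move=> nc fc gau; apply: (conv_inj (@act0 u)) => p.
rewrite -factor_conv // conv_quotient ?actU ?act1_irreducible //.
exact: act0.
Qed.

(** On normal words E_v(t) E_u(t)^-1 is a polynomial of degree at most |v| - |u|
    for v > u.  For words to which letters at v can be appended this is the
    factorization above.  For w = c(a,k) with (a,k) |= v, divide
    c E_a(t) = Q(t) E_v(t) by E_u(t): the left-hand side has degree at most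
    |a| - |u| = k + |v| - |u|, and the coefficients of Q other than w are either
    words of the first kind or the shorter word c. *)
Lemma divop_deg w v u i : gtv v u -> normal w ->
  (lev v - lev u < i)%N -> divop (act u) (act v) i << w >> = 0.
Proof.
move=> gvu; set d := (lev v - lev u)%N.
have factor_big a c k j : (k < j)%N -> factor a u c k j = 0.
  by case: j => // j ltkj; rewrite /factor ltnNge -ltnS ltkj addr0.
have divop_extendable n j : inspan (extendable v) n -> (d < j)%N ->
    divop (act u) (act v) j n = 0.
  move=> nn ltj; rewrite linear_malgE big_seq big1 // => w'.
  rewrite -mcoeff_neq0 => /nn /andP[nw' fw'].
  by rewrite /= divop_factor // factor_big ?scaler0.
elim: w i => [|[a k] c IHc] i nw lti.
  by apply: divop_extendable => //; apply: inspanU.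
have [akb|akg] := boolP (reducible (a, k) v); last first.
  by apply: divop_extendable => //; apply: inspanU; rewrite /extendable nw.
have [k_range fc nc] : [/\ (1 <= k <= lev a)%N, follows c a & normal c].
  by apply/and3P; rewrite normal_cons in nw.
have /andP[/asboolP /= gav /eqP /= lvE] := akb.
have gau : gtv a u := gtv_trans gav gvu.
have ltuv := gtv_lev lev_edge gvu.
have kE : (lev a - lev v = k)%N by lia.
have closed_c l : (0 < l)%N -> inspan (extendable v) (act1 c v l).
  exact: act1_extendable.
pose Q := factor a v c k.
have /(conv_inj (@act0 u)) HQ : conv (act u) (factor a u c (lev a - lev u)) =1
    conv (act u) (fun p =>
      \sum_(j < p.+1) divop (act u) (act v) (p - j)%N (Q j)).
  by move=> m; rewrite -conv_divop ?/Q -?kE -?factor_conv //; apply: act0.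
(* The coefficient of t^(k+i), which vanishes on the left-hand side. *)
have := HQ (k + i)%N; rewrite factor_big; last by rewrite -/d; lia.
have Q_big j : (k < j)%N -> Q j = 0.
  by case: j => // j ltkj; rewrite /Q /factor ltnNge -ltnS ltkj addr0.
rewrite (@sum_ord_cut _ (fun j => divop (act u) (act v) (k + i - j)%N (Q j)) k);
  [|exact: leq_addr|by move=> j ltkj; rewrite Q_big ?linear0].
rewrite big_ord_recr big1 ?add0r /=; last first.
  move=> [j ltjk] _ /=; rewrite /Q /factor (ltnW ltjk) linearD /=.
  rewrite [X in _ + X]divop_extendable ?addr0; last by lia.
  - case: j ltjk => [|j] ltjk; last by rewrite linear0.
    by rewrite IHc //; lia.
  - exact: (tail_extendable nc fc k_range akb closed_c).
have -> : (k + i - k = i)%N by lia.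
have -> : Q k = << (a, k) :: c >> + (tail a v c k - << (a, k) :: c >>).
  rewrite addrC subrK /Q /factor leqnn.
  by case: (k) k_range => // k' _; rewrite add0r.
rewrite linearD /=.
rewrite (divop_extendable _ _ (tail_top nc fc k_range akb closed_c) lti).
by rewrite addr0 add0r.
Qed.

(** The edge e is the class e(v,1) - e(w,1) in A(Gamma). *)
Definition edgeop (e : edge G) : {linear N -> N} :=
  act (etail e) 1 \- act (ehead e) 1.

(** The relation E_v(t) = (1 + t e) E_w(t), as the quotient has degree at most
    1 and the coefficients of 1 and t determine it. *)
Lemma act_edge e n m : inspan normal n ->
  act (etail e) m n = act (ehead e) m n
    + (if m is m'.+1 then act (ehead e) m' (edgeop e n) else 0).
Proof.
move=> nn; set v := etail e; set w := ehead e.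
pose D i := divop (act w) (act v) i n.
have DE p : act v p n = conv (act w) D p.
  by rewrite conv_quotient //; apply: act0.
have D0 : D 0%N = n by have := DE 0%N; rewrite /conv big_ord1 !act0.
have D_big i : (1 < i)%N -> D i = 0.
  move=> lti; rewrite /D linear_malgE big_seq big1 // => b.
  rewrite -mcoeff_neq0 => /nn nb; rewrite /= divop_deg ?scaler0 //.
    exact: gtv_edge.
  by rewrite /v /w lev_edge; lia.
have D1 : D 1%N = edgeop e n.
  have := DE 1%N; rewrite /conv big_ord_recl big_ord1 /= D0 subn0 /bump /= act0.
  by rewrite /edgeop /= -/v -/w => ->; rewrite addrAC subrr add0r.
rewrite DE /conv big_ord_recl D0 subn0; congr (_ + _).
case: m => [|m]; first by rewrite big_ord0.
rewrite big_ord_recl /= /bump /= D1 subSS subn0 big1 ?addr0 // => i _.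
by rewrite D_big ?linear0.
Qed.

Lemma edgeop_normal e n : inspan normal n -> inspan normal (edgeop e n).
Proof. by move=> nn; rewrite /edgeop /=; apply: inspanB; apply: act_normal. Qed.

(** * The action of the free algebra *)

Local Notation T := (freeAlg F G).

Definition monop (s : seq (edge G)) n : N :=
  foldl (fun n' e => edgeop e n') n s.

Lemma monop_cons e s n : monop (e :: s) n = monop s (edgeop e n).
Proof. by []. Qed.

Lemma monop_is_linear s : linear (monop s).
Proof. by elim: s => // e s IHs k n n'; rewrite !monop_cons linearP IHs. Qed.
HB.instance Definition _ s :=
  GRing.isLinear.Build F N N *:%R (monop s) (monop_is_linear s).

Definition freeop n : {linear T -> N} :=
  lext (fun m : {fmonom edge G} => monop m n).

Lemma freeopU n (m : {fmonom edge G}) : freeop n << m >> = monop m n.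
Proof. exact: lextU. Qed.

Lemma freeop1 n : freeop n 1 = n.
Proof. by rewrite (freeopU n mone) fm1. Qed.

Lemma freeop_egen n e : freeop n (egen F e) = edgeop e n.
Proof. by rewrite freeopU fmU. Qed.

Lemma freeopM n (x y : T) : freeop n (x * y) = freeop (freeop n x) y.
Proof.
rewrite malgME linear_sum [RHS]linear_malgE.
under [RHS]eq_bigr => m2 _ do
  rewrite freeopU [freeop n x]linear_malgE linear_sum scaler_sumr.
rewrite exchange_big /=; apply: eq_bigr => m1 _; rewrite linear_sum.
apply: eq_bigr => m2 _; rewrite malgU_scale linearZ !freeopU /= linearZ /=.
rewrite scalerA mulrC; congr (_ *: _).
by rewrite /monop fmM foldl_cat.
Qed.

Lemma freeop_normal n (x : T) : inspan normal n -> inspan normal (freeop n x).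
Proof.
move=> nn; rewrite linear_malgE; apply: inspan_sum => m _; apply: inspanZ.
rewrite freeopU /monop; elim: (m : seq _) n nn => // e s IHs n nn /=.
exact/IHs/edgeop_normal.
Qed.

End RightModule.

(** * Path polynomials in the free algebra *)

Lemma coef_sign_mul (R : nzRingType) (P Q : {poly R}) m :
  (-1) ^+ m * (P * Q)`_m
    = \sum_(i < m.+1) ((-1) ^+ i * P`_i) * ((-1) ^+ (m - i)%N * Q`_(m - i)%N).
Proof.
rewrite coefM mulr_sumr; apply: eq_bigr => i _.
rewrite -{1}(subnKC (ltn_ord i : (i <= m)%N)) exprD -!mulrA; congr (_ * _).
by rewrite !mulrA (commr_sign P`_i).
Qed.

Section FreePaths.
Variables (F : fieldType) (G : digraph).
Implicit Types (e : edge G) (p q : seq (edge G)).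

Lemma epath_nil j : epath F ([::] : seq (edge G)) j = (j == 0%N)%:R.
Proof.
rewrite /epath /pathpoly big_nil coef1.
by case: j => [|j]; rewrite ?mulr0 // expr0 mul1r.
Qed.

Lemma epath_cat p q m :
  epath F (p ++ q) m = \sum_(i < m.+1) epath F p i * epath F q (m - i)%N.
Proof. by rewrite /epath /pathpoly big_cat /= coef_sign_mul. Qed.

Lemma epath_edge e j : epath F [:: e] j =
  match j with 0 => 1 | 1 => egen F e | _ => 0 end.
Proof.
rewrite /epath /pathpoly big_seq1 coefB coef1 coefCM coefX.
case: j => [|[|j]] /=.
- by rewrite mulr0 subr0 expr0 mulr1.
- by rewrite expr1 mulN1r mulr1 sub0r opprK.
- by rewrite mulr0 subr0 mulr0.
Qed.

Lemma epath_cons e p j : epath F (e :: p) j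
  = epath F p j + (if j is j'.+1 then egen F e * epath F p j' else 0).
Proof.
rewrite -cat1s epath_cat big_ord_recl epath_edge mul1r subn0; congr (_ + _).
case: j => [|j]; first by rewrite big_ord0.
rewrite big_ord_recl epath_edge subSS subn0 big1 ?addr0 // => i _.
by rewrite epath_edge mul0r.
Qed.

Lemma epath0 p : epath F p 0 = 1.
Proof.
elim: p => [|e p IHp]; first by rewrite epath_nil eqxx; exact: mulr1n.
by rewrite epath_cons IHp; exact: addr0.
Qed.

Lemma epath_big p j : (size p < j)%N -> epath F p j = 0.
Proof.
elim: p j => [|e p IHp] [|j] // ltpj; first by rewrite epath_nil.
by rewrite epath_cons !IHp ?mulr0 ?addr0 // ltnW.
Qed.
End FreePaths.

(** Multiplication of f(t) + t g(t) by T(t). *)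
Lemma conv_shift (F : fieldType) (N : lmodType F) (T : nat -> {linear N -> N})
    (f g : nat -> N) m :
  conv T (fun i => f i + (if i is i'.+1 then g i' else 0)) m
    = conv T f m + (if m is m'.+1 then conv T g m' else 0).
Proof.
rewrite /conv; under eq_bigr => i _ do rewrite linearD.
rewrite big_split; congr (_ + _); rewrite big_ord_recl /= linear0 add0r.
by case: m => [|m]; rewrite ?big_ord0.
Qed.

Lemma conv_sub1 (R : pzRingType) (f x : nat -> R) m : f 0%N = 1 ->
  \sum_(i < m.+1) f i * x (m - i)%N - x m
    = \sum_(i < m.+1) (if i : nat is 0 then 0 else f i) * x (m - i)%N.
Proof.
move=> f0; rewrite big_ord_recl f0 mul1r subn0 addrC addKr.
by rewrite [RHS]big_ord_recl mul0r add0r.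
Qed.

Lemma conv_last (R : pzRingType) (f x : nat -> R) m : x 0%N = 1 ->
  \sum_(i < m.+1) f i * x (m - i)%N = \sum_(i < m) f i * x (m - i)%N + f m.
Proof. by move=> x0; rewrite big_ord_recr subnn x0 mulr1. Qed.

(** * Comparison of the module with the algebra *)

Section Relations.
Variables (F : fieldType) (G : digraph) (lev : vertex G -> nat).
Variables (star : vertex G) (ev : {v : vertex G | v != star} -> edge G).
Hypothesis lev_edge : forall e : edge G, lev (etail e) = (lev (ehead e)).+1.
Hypothesis lev0 : forall v : vertex G, lev v = 0%N <-> v = star.
Hypothesis evP : forall u : {v : vertex G | v != star}, etail (ev u) = val u.
Local Notation T := (freeAlg F G).
Local Notation N := {malg F[word G]}.
Local Notation act := (act F lev).
Local Notation freeop := (freeop lev).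
Local Notation normalspan := (inspan (normal lev)).
Implicit Types (n : N) (v w : vertex G) (p : seq (edge G)).

(** E_v(t) = P_p(t) E_w(t) holds for the action, edge by edge along p. *)
Lemma act_walk v w p n m : walk v w p -> normalspan n ->
  act v m n = conv (act w) (fun i => freeop n (epath F p i)) m.
Proof.
elim: p v n m => [|e p IHp] v n m.
  move=> /eqP <- nn; rewrite /conv big_ord_recl subn0 epath_nil.
  rewrite [X in freeop n X](_ : _ = 1); last by [].
  rewrite freeop1 big1 ?addr0 // => i _.
  by rewrite epath_nil [X in freeop n X](_ : _ = 0) // linear0 linear0.
rewrite walk_cons => /andP[/eqP <- ep] nn.
pose g i := freeop (edgeop F lev e n) (epath F p i).
transitivity (conv (act w) (fun i =>
  freeop n (epath F p i) + (if i is i'.+1 then g i' else 0)) m); last first.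
  apply: eq_bigr => i _; congr (_ _); rewrite epath_cons linearD; congr (_ + _).
  case: (i : nat) => [|j]; first by rewrite linear0.
  by rewrite freeopM freeop_egen.
rewrite conv_shift act_edge // (IHp _ n) //; congr (_ + _).
by case: m => // m; apply: IHp => //; apply: edgeop_normal.
Qed.

(** The normal span, rather than all of N, is the module over A(Gamma). *)
Definition annihilator : set T :=
  [set x | forall n, normalspan n -> freeop n x = 0]%classic.

Lemma annihilator_ideal : two_sided_ideal annihilator.
Proof.
split=> [n _|x y Ax Ay n nn|a x Ax n nn|a x Ax n nn].
- exact: linear0.
- by rewrite linearB Ax // Ay // subrr.
- by rewrite freeopM Ax //; apply: freeop_normal.
- rewrite freeopM Ax // linear_malgE big1 // => m _.
  by rewrite freeopU linear0 scaler0.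
Qed.

Lemma path_walk v w p : is_path v w p -> walk v w p.
Proof. by case: p. Qed.

(** Two paths p, q from v to w satisfy P_p(t) E_w(t) = E_v(t) = P_q(t) E_w(t) on
    the normal span, and E_w(t) can be cancelled. *)
Lemma relators_annihilate x n :
  ideal_gen (@relators F G) x -> normalspan n -> freeop n x = 0.
Proof.
move=> /(_ annihilator) Ax; apply: Ax; split; first exact: annihilator_ideal.
move=> _ [p [q [v [w [k [/path_walk vp /path_walk vq _ ->]]]]]] n' nn'.
rewrite linearB; apply/eqP; rewrite subr_eq0; apply/eqP.
move: k; apply: (conv_inj (@act0 F G lev w)) => m.
exact: (etrans (esym (act_walk m vp nn')) (act_walk m vq nn')).
Qed.

Lemma canon_path_walk v : walk v star (canon_path lev ev v).
Proof.
rewrite /canon_path; move lvE: (lev v) => k; elim: k v lvE => [|k IHk] v lvE.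
  by apply/eqP/lev0.
have v_star : v != star by apply/eqP => /lev0; rewrite lvE.
rewrite /canon_walk -/(canon_walk ev) insubT walk_cons evP eqxx.
apply: IHk; apply/eqP; rewrite -eqSS -lev_edge evP.
by rewrite lvE.
Qed.

Lemma size_canon_path v : size (canon_path lev ev v) = lev v.
Proof.
have := walk_lev lev_edge (canon_path_walk v).
by rewrite (_ : lev star = 0%N) //; apply/lev0.
Qed.

(** The path pi_v ends at the minimal vertex, where E(t) = 1. *)
Lemma freeop_evert v m n : normalspan n ->
  freeop n (evert F lev ev v m) = act v m n.
Proof.
move=> nn; rewrite (act_walk _ (canon_path_walk v) nn).
rewrite conv_recr; last exact: act0.
rewrite big1 ?add0r // => i _; apply: act_big.
by rewrite (_ : lev star = 0%N) ?subn_gt0 //; apply/lev0.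
Qed.

(** A normal word is built from the empty one by appending its letters, without
    ever meeting the reducible case of the action. *)
Lemma freeop_word (b : word G) : normal lev b ->
  freeop << [::] >> (\prod_(x <- rev b) evert F lev ev x.1 x.2) = << b >>.
Proof.
elim: b => [|[v m] b IHb]; first by rewrite big_nil freeop1.
rewrite normal_cons => /and3P[m_range fb nb].
rewrite rev_cons -cats1 big_cat freeopM IHb // big_seq1.
rewrite freeop_evert; last exact: inspanU.
rewrite actU act1_irreducible //=; case: m m_range {fb} => // m /andP[_ lem].
by rewrite /append1 lem.
Qed.

Local Notation A := (AG F G).
Local Notation E := (etilde F lev ev).
Let proj : T -> A := to_quot (@relators F G).

Lemma projD x y : proj (x + y) = proj x + proj y. Proof. exact: to_quotD. Qed.
Lemma proj0 : proj 0 = 0. Proof. exact: to_quot0. Qed.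
Lemma projM x y : proj (x * y) = proj x * proj y.
Proof. exact: (esym (to_quot_mul _ x y)). Qed.
Lemma proj1 : proj 1 = 1. Proof. by []. Qed.
Lemma projZ c x : proj (c *: x) = c *: proj x.
Proof. exact: (esym (to_quot_scale _ c x)). Qed.
Lemma proj_sum (I : Type) (s : seq I) (f : I -> T) :
  proj (\sum_(i <- s) f i) = \sum_(i <- s) proj (f i).
Proof. exact: (big_morph proj projD proj0). Qed.

(** Outside the range 1 <= j <= size p of the relators both sides are equal
    already in the free algebra, as p and q have the same length. *)
Lemma proj_path v w p q j : walk v w p -> walk v w q ->
  proj (epath F p j) = proj (epath F q j).
Proof.
move=> vp vq; have size_pq : size p = size q.
  apply/eqP; rewrite -(eqn_add2l (lev w)).
  by rewrite -(walk_lev lev_edge vp) -(walk_lev lev_edge vq).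
case: j => [|j]; first by rewrite !epath0.
have [ltj|lej] := ltnP (size p) j.+1; first by rewrite !epath_big // -size_pq.
apply/to_quot_eq => I [_ IR]; apply: IR.
exists p, q, v, w, j.+1; split=> //; first by case: (p) vp lej.
by case: (q) size_pq vq lej => // ->.
Qed.

(** E_v(t) = P_p(t) E_w(t) in A(Gamma): compare pi_v with p followed by pi_w. *)
Lemma etilde_walk v w p m : walk v w p ->
  E v m = \sum_(i < m.+1) proj (epath F p i) * E w (m - i)%N.
Proof.
move=> vp; have vc := walk_cat vp (canon_path_walk w).
transitivity (proj (epath F (p ++ canon_path lev ev w) m)).
  exact: (proj_path m (canon_path_walk v) vc).
by rewrite epath_cat proj_sum; apply: eq_bigr => i _; exact: projM.
Qed.

Lemma etilde0 v : E v 0 = 1.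
Proof. by rewrite /etilde -/proj /evert epath0 proj1. Qed.

Lemma etilde_big v m : (lev v < m)%N -> E v m = 0.
Proof.
move=> ltm; rewrite /etilde -/proj /evert.
by rewrite epath_big ?size_canon_path ?proj0.
Qed.

Lemma proj_egen e : proj (egen F e) = E (etail e) 1 - E (ehead e) 1.
Proof.
have he : walk (etail e) (ehead e) [:: e] by rewrite walk_cons /walk !eqxx.
rewrite (etilde_walk _ he) big_ord_recl big_ord1 !epath_edge etilde0 proj1.
by rewrite mul1r mulr1 addrC addKr.
Qed.

Definition wordval : {linear N -> A} :=
  lext (fun b : word G => etilde_seq F lev ev (rev b)).

Lemma wordvalU b : wordval << b >> = etilde_seq F lev ev (rev b).
Proof. exact: lextU. Qed.

Lemma wordval_nil : wordval << [::] >> = 1.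
Proof. by rewrite wordvalU /etilde_seq big_nil. Qed.

Lemma wordval_cons v m (b : word G) :
  wordval << (v, m) :: b >> = wordval << b >> * E v m.
Proof. by rewrite !wordvalU /etilde_seq rev_cons -cats1 big_cat big_seq1. Qed.

Lemma wordval_right (f : {linear N -> N}) (z : A) n :
  (forall b : word G, wordval (f << b >>) = wordval << b >> * z) ->
  wordval (f n) = wordval n * z.
Proof.
move=> fz; rewrite (linear_malgE f) linear_sum [in RHS]linear_malgE mulr_suml.
by apply: eq_bigr => b _; rewrite linearZ fz -[RHS]quot_scaleAl.
Qed.

Lemma wordval_append u l n : wordval (append F lev u l n) = wordval n * E u l.
Proof.
apply: wordval_right => b; rewrite appendU /append1; case: l => [|l].
  by rewrite etilde0 mulr1.
by case: leqP => ltl; rewrite ?wordval_cons // linear0 etilde_big ?mulr0.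
Qed.

(** The action was forced by the relations of A(Gamma), so it becomes right
    multiplication there.  For the word c(a,k) with (a,k) |= u, take a path p
    from a to u: the series r(t) and q(t) of the action become
    c (E_a(t) - E_u(t)) and c (P_p(t) - 1), and P_p has degree at most k, so the
    correction to the naive action vanishes. *)
Lemma wordval_act u l n : wordval (act u l n) = wordval n * E u l.
Proof.
apply: wordval_right => b; rewrite actU; elim: b u l => [|[a k] c IHc] u l.
  by rewrite act1_irreducible // -appendU wordval_append.
have [akb|akg] := boolP (reducible lev (a, k) u); last first.
  by rewrite act1_irreducible // -appendU wordval_append.
rewrite act1_reducible // linearD -appendU wordval_append.
rewrite [X in _ + X](_ : _ = 0) ?addr0 //.
have /andP[/asboolP /= [p ap] /eqP /= luE] := akb.
have {}ap : walk a u p by apply: path_walk.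
have size_p : (size p <= k)%N by have := walk_lev lev_edge ap; lia.
pose P (i : nat) : A := if i is 0 then 0 else proj (epath F p i).
have P_conv m : E a m - E u m = \sum_(i < m.+1) P i * E u (m - i)%N.
  rewrite (etilde_walk m ap).
  apply: (@conv_sub1 A (fun i => proj (epath F p i)) (E u)).
  by rewrite epath0.
have defectE m : wordval (defect F lev a u c m)
    = wordval << c >> * \sum_(i < m.+1) P i * E u (m - i)%N.
  by rewrite -P_conv /defect linearB IHc -appendU wordval_append mulrBr.
have tailE i : wordval (tail F lev a u c i) = wordval << c >> * P i.
  have [m] := ubnP i; elim: m i => // m IHm i ltim.
  have -> : tail F lev a u c i = defect F lev a u c i
      - \sum_(j < i) append F lev u (i - j) (tail F lev a u c j).
    exact: quotient_rec.
  have sumE : wordval (\sum_(j < i) append F lev u (i - j) (tail F lev a u c j))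
      = wordval << c >> * \sum_(j < i) P j * E u (i - j)%N.
    rewrite mulr_sumr linear_sum; apply: eq_bigr => j _.
    by rewrite wordval_append IHm ?mulrA //; have := ltn_ord j; lia.
  rewrite linearB sumE defectE (conv_last P i (etilde0 u)) mulrDr.
  exact: (etrans (addrC _ _) (addKr _ _)).
have cut : \sum_(i < (k + l).+1) P i * E u (k + l - i)%N
    = \sum_(i < k.+1) P i * E u (k + l - i)%N.
  apply: (@sum_ord_cut _ (fun i => P i * E u (k + l - i)%N)).
    exact: leq_addr.
  move=> [|i] ltki; first exact: mul0r.
  by rewrite /P epath_big ?proj0 ?mul0r //; apply: leq_ltn_trans ltki.
have sumE :
  wordval (\sum_(i < k.+1) append F lev u (k + l - i) (tail F lev a u c i))
    = wordval << c >> * \sum_(i < k.+1) P i * E u (k + l - i)%N.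
  rewrite mulr_sumr linear_sum; apply: eq_bigr => i _.
  by rewrite wordval_append tailE mulrA.
by rewrite linearB defectE cut sumE; exact: subrr.
Qed.

Lemma egen_monom e (s : seq (edge G)) :
  egen F e * << FMonom s >> = << FMonom (e :: s) >> :> T.
Proof.
rewrite [LHS]fgmulUU mulr1; congr << _ *g _ >>.
by rewrite [LHS]fmmulE fmuE.
Qed.

Lemma wordval_monop n (s : seq (edge G)) :
  wordval (monop lev s n) = wordval n * proj << FMonom s >>.
Proof.
elim: s n => [|e s IHs] n; first by rewrite -fmoneE; exact: (esym (mulr1 _)).
have edgeE : wordval (edgeop F lev e n) = wordval n * proj (egen F e).
  rewrite [edgeop F lev e n](_ : _ = act (etail e) 1 n - act (ehead e) 1 n) //.
  by rewrite linearB !wordval_act proj_egen; exact: (esym (mulrBr _ _ _)).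
rewrite monop_cons IHs edgeE -mulrA; congr (_ * _).
apply: etrans (congr1 proj (egen_monom e s)).
exact: (esym (projM (egen F e) << FMonom s >>)).
Qed.

Lemma wordval_freeop (x : T) : wordval (freeop << [::] >> x) = proj x.
Proof.
rewrite [freeop _ x]linear_malgE linear_sum [in RHS](malg_sumU x) proj_sum.
apply: eq_bigr => m _; rewrite linearZ projZ; congr (_ *: _).
by rewrite freeopU wordval_monop wordval_nil mul1r fmK.
Qed.

(** A preimage in the free algebra, applied to the empty word, is a combination
    of normal words with the prescribed value. *)
Lemma etilde_seq_spanning : spanning (Bset lev) (etilde_seq F lev ev).
Proof.
move=> x; set n := freeop << [::] >> (repr x).
have nn : normalspan n by apply: (freeop_normal lev_edge); apply: inspanU.
exists [seq rev b | b <- msupp n], (fun b => n@_(rev b)); split.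
  move=> _ /mapP[b bn ->]; apply/Bset_normal; rewrite revK; apply: nn.
  by rewrite mcoeff_neq0.
rewrite -[LHS]repK -[LHS]wordval_freeop -/n linear_malgE big_map.
by apply: eq_bigr => b _; rewrite wordvalU revK.
Qed.

(** Apply a vanishing combination to the empty word: distinct elements of
    B(Gamma) give distinct basis words of N. *)
Lemma etilde_seq_indep : lin_indep (Bset lev) (etilde_seq F lev ev).
Proof.
move=> s c s_uniq sB s0 b0 b0s.
pose free_word b : T := \prod_(x <- b) evert F lev ev x.1 x.2.
have projE b : proj (free_word b) = etilde_seq F lev ev b.
  exact: (big_morph proj projM proj1).
have y0 : proj (\sum_(b <- s) c b *: free_word b) = proj 0.
  rewrite proj0 -[RHS]s0 proj_sum; apply: eq_bigr => b _.
  by rewrite projZ projE.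
have /to_quot_eq := y0; rewrite subr0 => /relators_annihilate.
have n0 : normalspan (<< [::] >> : N) by apply: inspanU.
move=> /(_ _ n0).
have free_wordE b : Bset lev b -> freeop << [::] >> (free_word b) = << rev b >>.
  by move=> /Bset_normal /freeop_word; rewrite revK.
have -> : freeop << [::] >> (\sum_(b <- s) c b *: free_word b)
    = \sum_(b <- s) c b *: (<< rev b >> : N).
  rewrite linear_sum big_seq [RHS]big_seq; apply: eq_bigr => b bs.
  by rewrite linearZ free_wordE //; apply: sB.
move=> /(congr1 (mcoeff (rev b0))); rewrite mcoeff0 raddf_sum.
rewrite (bigD1_seq b0) //= mcoeffZ mcoeffUU mulr1 big1 ?addr0 // => b neqb.
by rewrite mcoeffZ mcoeffU (inj_eq (can_inj revK)) (negPf neqb) mulr0.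
Qed.
End Relations.

Theorem theorem4p3 (F : fieldType) (G : digraph) (n : nat)
    (lev : vertex G -> nat) (star : vertex G)
    (ev : {v : vertex G | v != star} -> edge G) :
  layered n lev ->
  (forall v : vertex G, lev v = 0%N <-> v = star) ->
  unique_minimal star ->
  (forall u : {v : vertex G | v != star}, etail (ev u) = val u) ->
  is_basis (Bset lev) (etilde_seq F lev ev).
Proof.
move=> [_ lev_edge] lev0 _ evP; split.
  exact: etilde_seq_indep.
exact: etilde_seq_spanning.
Qed.
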